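(* Let $\kappa$ be an uncountable cardinal with $2^{<\kappa}=\kappa$, and let $X$ be a nonempty regular Hausdorff space of weight at most $\kappa$. Given any $1<\alpha<\kappa^+$, let $\widehat{\alpha}=\operatorname{cof}(\kappa)$ if $\alpha$ is a successor ordinal, and $\widehat{\alpha}=\operatorname{cof}(\alpha)$ if $\alpha$ is limit. Then: (1) $\kappa^+\text{-}\boldsymbol{\Sigma}^0_\alpha(X)$ is closed under unions of length $\kappa$ and intersections of size smaller than $\widehat{\alpha}$; (2) $\kappa^+\text{-}\boldsymbol{\Pi}^0_\alpha(X)$ is closed under intersections of length $\kappa$ and unions of size smaller than $\widehat{\alpha}$; (3) $\kappa^+\text{-}\boldsymbol{\Delta}^0_\alpha(X)$ is closed under complements and both unions and intersections of size smaller than $\widehat{\alpha}$, that is, $\kappa^+\text{-}\boldsymbol{\Delta}^0_\alpha(X)$ is a $\widehat{\alpha}$-algebra. Furthermore, the same is true for $\alpha=1$ (with $\widehat{1}=\operatorname{cof}(\kappa)$) if $X$ is $\operatorname{cof}(\kappa)$-additive.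
   Context: For a topological space $X$, define by recursion on ordinals $\alpha\ge1$: $\kappa^+\text{-}\boldsymbol{\Sigma}^0_1(X)$ is the family of open sets; for $\alpha>1$, $\kappa^+\text{-}\boldsymbol{\Sigma}^0_\alpha(X)$ is the family of all unions of at most $\kappa$-many sets from $\bigcup_{1\le\beta<\alpha}\kappa^+\text{-}\boldsymbol{\Pi}^0_\beta(X)$; $\kappa^+\text{-}\boldsymbol{\Pi}^0_\alpha(X)$ is the family of complements of sets in $\kappa^+\text{-}\boldsymbol{\Sigma}^0_\alpha(X)$; $\kappa^+\text{-}\boldsymbol{\Delta}^0_\alpha(X)=\kappa^+\text{-}\boldsymbol{\Sigma}^0_\alpha(X)\cap\kappa^+\text{-}\boldsymbol{\Pi}^0_\alpha(X)$. A $\nu$-algebra on $X$ is a family of subsets of $X$ closed under complements and well-ordered unions of length less than $\nu$. A space is $\nu$-additive if the intersection of any collection of fewer than $\nu$-many open sets is open. *)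

(* Defs.v *)
From mathcomp Require Import all_boot all_order.
From mathcomp Require Import boolp classical_sets functions cardinality.
From mathcomp Require Import wochoice topology separation_axioms.

Set Implicit Arguments.
Unset Strict Implicit.
Unset Printing Implicit Defensive.

Import Order.TTheory.
Local Open Scope classical_set_scope.
Local Open Scope card_scope.
Local Open Scope order_scope.

(* Strict comparison of cardinalities. *)
Definition card_lt (T U : Type) (A : set T) (B : set U) : Prop :=
  (A #<= B) && ~~ (B #<= A).

(** * Ordinals

   Ordinals are the elements of a type [Om] well-ordered by [<=], which plays
   the role of an initial segment of the class of all ordinals. The element [a]
   stands for the order type of its set of predecessors [below a], so 0 is
   [\bot], and cardinals are initial ordinals. The theory only ever involves
   ordinals bounded by some element of [Om]. *)

Section Ordinals.
Context {d : Order.disp_t} {Om : bOrderType d}.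
Implicit Types (a b c g k l m : Om).

Definition below a : set Om := [set x | x < a].

Definition succ_of b a : Prop := b < a /\ forall c, b < c -> a <= c.

Definition is_successor a : Prop := exists b, succ_of b a.

(* The value is irrelevant if [Om] is reduced to [\bot]. *)
Definition ord_one : Om := xget \bot [set a | succ_of \bot a].

Definition is_cardinal k : Prop := forall a, a < k -> card_lt (below a) (below k).

Definition is_succ_cardinal k m : Prop :=
  [/\ is_cardinal m, k < m & forall l, is_cardinal l -> k < l -> m <= l].

Definition has_cofinal_map a g : Prop :=
  exists2 f : Om -> Om, (forall x, x < g -> f x < a) &
    forall b, b < a -> exists2 x, x < g & b <= f x.

(* The default value of [xget] is never used, see [cofP]. *)
Definition cof a : Om :=
  xget a [set g | has_cofinal_map a g /\
                  forall g', has_cofinal_map a g' -> g <= g'].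

Lemma cofP a : well_order (<=%O : rel Om) ->
  has_cofinal_map a (cof a) /\ forall g, has_cofinal_map a g -> cof a <= g.
Proof.
move=> wo; rewrite /cof; case: xgetP => [g _ //|none].
have [|g [[/asboolP ag gmin] _]] := wo [pred g | `[< has_cofinal_map a g >]].
  exists a; apply/asboolP; exists id => // b ltba.
  by exists b.
case: (none g); split=> // g' ag'.
by apply: gmin; apply/asboolP.
Qed.

(* 2^{<k} = k, where 2^{<k} is the supremum of the cardinals 2^l for l < k:
   k is the least cardinal m such that 2^l <= m for all cardinals l < k. *)
Definition weak_power_bound k m : Prop :=
  forall l, is_cardinal l -> l < k ->
    [set A : set Om | A `<=` below l] #<= below m.

Definition weak_power_eq k : Prop :=
  weak_power_bound k k /\
  forall m, is_cardinal m -> weak_power_bound k m -> k <= m.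

(* The ordinal written as alpha with a hat; 1 is a successor. *)
Definition hat k a : Om := if `[< is_successor a >] then cof k else cof a.

End Ordinals.

(** * Topology and the generalized Borel hierarchy *)

Section Hierarchy.
Context {d : Order.disp_t} {Om : bOrderType d} {X : topologicalType}.
Implicit Types (a nu k : Om) (S : set (set X)).

Definition weight_le k : Prop :=
  exists2 B : set (set X), basis B & B #<= below k.

Definition additive nu : Prop :=
  forall C : set (set X), C `<=` open -> card_lt C (below nu) ->
    open (\bigcap_(A in C) A).

(* The recursion on [a] is presented as a mutual inductive definition: the
   clauses for level [a] only refer to levels below [a], so the least solution
   is the unique one. Nothing lives at level 0. *)
Inductive Sigma0 (k : Om) : Om -> set X -> Prop :=
| Sigma0_open (A : set X) : open A -> Sigma0 k ord_one A
| Sigma0_bigcup (a : Om) (C : set (set X)) : ord_one < a -> C #<= below k ->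
    (forall B, C B -> exists2 b : Om, ord_one <= b < a & Pi0 k b B) ->
    Sigma0 k a (\bigcup_(B in C) B)
with Pi0 (k : Om) : Om -> set X -> Prop :=
| Pi0_setC (a : Om) (A : set X) : Sigma0 k a A -> Pi0 k a (~` A).

Definition Delta0 k a : set (set X) := Sigma0 k a `&` Pi0 k a.

Definition closed_setC S : Prop := forall A, S A -> S (~` A).

(* Unions and intersections of sequences of length [nu]. *)
Definition closed_bigcup_length nu S : Prop :=
  forall F : Om -> set X, (forall i, i < nu -> S (F i)) ->
    S (\bigcup_(i in below nu) F i).

Definition closed_bigcap_length nu S : Prop :=
  forall F : Om -> set X, (forall i, i < nu -> S (F i)) ->
    S (\bigcap_(i in below nu) F i).

(* Unions and intersections of collections of size smaller than [nu]; the
   intersection of the empty collection is the whole space. *)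
Definition closed_bigcup_lt nu S : Prop :=
  forall C : set (set X), C `<=` S -> card_lt C (below nu) ->
    S (\bigcup_(A in C) A).

Definition closed_bigcap_lt nu S : Prop :=
  forall C : set (set X), C `<=` S -> card_lt C (below nu) ->
    S (\bigcap_(A in C) A).

Definition is_algebra nu S : Prop :=
  closed_setC S /\ forall g : Om, g < nu -> closed_bigcup_length g S.

Definition hierarchy_closure k a nu : Prop :=
  [/\ closed_bigcup_length k (Sigma0 k a) /\ closed_bigcap_lt nu (Sigma0 k a),
      closed_bigcap_length k (Pi0 k a) /\ closed_bigcup_lt nu (Pi0 k a) &
      [/\ closed_setC (Delta0 k a), closed_bigcup_lt nu (Delta0 k a),
          closed_bigcap_lt nu (Delta0 k a) & is_algebra nu (Delta0 k a)]].

End Hierarchy.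

Arguments weight_le {d Om} X k.
Arguments additive {d Om} X nu.
Arguments Sigma0 {d Om} X k _ _.
Arguments Pi0 {d Om} X k _ _.
Arguments Delta0 {d Om} X k a _.
Arguments hierarchy_closure {d Om} X k a nu.

(* Main.v *)
Require Import Defs.
From mathcomp Require Import all_boot all_order.
From mathcomp Require Import boolp classical_sets functions cardinality.
From mathcomp Require Import wochoice topology separation_axioms.

Set Implicit Arguments.
Unset Strict Implicit.
Unset Printing Implicit Defensive.

Import Order.TTheory.
Local Open Scope order_scope.
Local Open Scope classical_set_scope.
Local Open Scope card_scope.

(** In a regular space of weight at most [kappa] an open set is a union of at
   most [kappa] closed sets, so levels increase, and [Pi] sets of a level are
   [Sigma] sets of all later levels. Since [kappa * kappa = kappa], each
   [Sigma] class is closed under unions of [kappa] sets, and dually for [Pi].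
   Closure of [Sigma] at level [alpha] under intersections of fewer than
   [hat alpha] sets is then the only real issue; the statements for [Pi] and
   [Delta] follow by complementation.

   If [alpha] is the successor of [beta], each of the fewer than [cof kappa]
   sets is a union of [kappa] many [Pi] sets of level [beta]. Distribute the
   intersection over these unions: the result is a union, over the choice
   functions, of intersections of at most [kappa] many [Pi] sets of level
   [beta], which are again [Pi] of level [beta]. There are only
   [kappa^{<cof kappa} = kappa] choice functions ([card_functions_lt_cof]),
   because each is bounded below [kappa] and [2^{<kappa} = kappa].

   If [alpha] is limit, this count fails, as [cof alpha] may exceed
   [cof kappa]. Instead, filter each set by the levels of its pieces: it is the
   increasing union over [gamma < alpha] of the union of its pieces of level at
   most [gamma]. A point of the intersection of fewer than [cof alpha] sets lies
   in the [gamma]-th part of all of them for a common [gamma < alpha]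
   ([cof_bounded]), so the intersection is the union over [gamma < alpha] of
   intersections of [gamma]-th parts ([Sigma0_bigcap_limit]), and there are at
   most [kappa] many [gamma] as [alpha < kappa^+]. At level 1 the
   required intersections are exactly what additivity provides. *)

(** * Cardinal comparisons through total functions *)

Section Cardinality.
Context {T U : Type}.
Implicit Types (A : set T) (B : set U).

Lemma card_le_inj A B (f : T -> U) :
  (forall x, A x -> B (f x)) ->
  (forall x y, A x -> A y -> f x = f y -> x = y) -> A #<= B.
Proof.
move=> fAB fI; apply: (@card_le_trans _ _ _ (f @` A)).
  have : f @` A #= A by apply: inj_card_eq => x y /set_mem + /set_mem; exact: fI.
  by rewrite card_eq_le => /andP[].
by apply: subset_card_le => _ [x Ax <-]; exact: fAB.
Qed.

Lemma card_le_injP A B (u0 : U) : A #<= B ->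
  exists f : T -> U, (forall x, A x -> B (f x)) /\
    (forall x y, A x -> A y -> f x = f y -> x = y).
Proof.
move=> /card_leP[f].
exists (fun x => if pselect (A x) is left Ax
                 then val (f (SigSub (mem_set Ax))) else u0).
split=> [x Ax|x y Ax Ay].
  by case: pselect => // Ax'; exact: set_valP.
case: pselect => // Ax'; case: pselect => // Ay' /val_inj /inj H.
by have /(congr1 val) := H (in_setT _) (in_setT _).
Qed.

Lemma card_le_surjP A B (u0 : U) (t0 : T) : A #<= B ->
  exists g : U -> T, forall x, A x -> exists2 y, B y & g y = x.
Proof.
move=> /(card_le_injP u0)[f [fAB fI]].
have /choice[g gP] : forall y, exists t,
    (exists2 x, A x & f x = y) -> A t /\ f t = y.
  move=> y; have [[x Ax fxy]|no] := pselect (exists2 x, A x & f x = y).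
    by exists x.
  by exists t0 => /no.
exists g => x Ax; exists (f x); first exact: fAB.
have [|Ag fg] := gP (f x); first by exists x.
exact: fI.
Qed.

End Cardinality.

Lemma card_le_prod T T' U U' (A : set T) (A' : set T') (B : set U) (B' : set U')
    (u0 : U) (u0' : U') :
  A #<= B -> A' #<= B' -> A `*` A' #<= B `*` B'.
Proof.
move=> /(card_le_injP u0)[f [fAB fI]] /(card_le_injP u0')[g [gAB gI]].
apply: (@card_le_inj _ _ _ _ (fun p => (f p.1, g p.2))).
  by move=> [x y] [/= /fAB ? /gAB].
by move=> [x y] [x' y'] [/= ? ?] [/= ? ?] [/fI-> // /gI->].
Qed.

Lemma card_le_subsets T U (A : set T) (B : set U) (u0 : U) :
  A #<= B -> [set S | S `<=` A] #<= [set S | S `<=` B].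
Proof.
move=> /(card_le_injP u0)[f [fAB fI]].
apply: (@card_le_inj _ _ _ _ (fun S => f @` S)) => [S SA _ [x /SA Ax <-]|].
  exact: fAB.
suff main S S' : S `<=` A -> S' `<=` A -> f @` S = f @` S' -> S `<=` S'.
  by move=> S S' SA SA' e; rewrite eqEsubset; split; apply: main.
move=> SA SA' e x Sx; have : (f @` S) (f x) by exists x.
by rewrite e => -[y Sy /fI <-]; [|exact: SA'|exact: SA].
Qed.

(** Shifting along a sequence in [A] makes room for one more point. *)
Lemma infinite_setU1 T (A : set T) a : infinite_set A -> a |` A #<= A.
Proof.
move=> /infiniteP/(card_le_injP a)[i [iA iI]].
have {}iA n : A (i n) by exact: iA.
have {}iI m n : i m = i n -> m = n by exact: iI.
pose h x := if pselect (A x) is left _ then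
    (if pselect (exists n, x = i n) is left e then i (projT1 (cid e)).+1 else x)
  else i 0%N.
apply: (@card_le_inj _ _ _ _ h) => [x|x y].
  by rewrite /h; case: pselect => // ? _; case: pselect.
have aP z : (a |` A) z -> ~ A z -> z = a by case.
move=> Ax Ay; rewrite /h.
pose range z := exists n, z = i n.
case: (pselect (A x)) => [_|nAx]; case: (pselect (A y)) => [_|nAy].
- case: (pselect (range x)) => [ex|nx]; case: (pselect (range y)) => [ey|ny] //.
  + move=> /iI[/(congr1 i)]; rewrite -(projT2 (cid ey)).
    exact: etrans (projT2 (cid ex)).
  + by move=> xy; case: ny; eexists; rewrite -xy.
  + by move=> xy; case: nx; eexists; rewrite xy.
- case: (pselect (range x)) => [ex|nx]; first by move=> /iI.
  by move=> xy; case: nx; exists 0%N.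
- case: (pselect (range y)) => [ey|ny]; first by move=> /iI.
  by move=> xy; case: ny; exists 0%N.
- by rewrite (aP _ Ax nAx) (aP _ Ay nAy).
Qed.

(** * Well-founded ranks *)

Lemma wf_of_minimal T (R : T -> T -> Prop) :
  (forall P : set T, P !=set0 -> exists2 m, P m & forall y, P y -> ~ R y m) ->
  well_founded R.
Proof.
move=> minR; apply: contrapT => /existsNP[x nAx].
have [m nAm mmin] := minR [set x | ~ Acc R x] (ex_intro _ x nAx).
by apply: nAm; constructor => y Rym; apply: contrapT => /mmin.
Qed.

Section Ordinals.
Context {d : Order.disp_t} {Om : bOrderType d}.
Context (Om_wo : well_order (<=%O : rel Om)).
Implicit Types (a b c g k l m : Om).

Lemma wo_min (P : set Om) x : P x -> exists2 m, P m & forall y, P y -> m <= y.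
Proof.
move=> Px; have [|m [[/asboolP Pm mmin] _]] := Om_wo (A := [pred y | `[< P y >]]).
  by exists x; apply/asboolP.
by exists m => // y Py; apply: mmin; apply/asboolP.
Qed.

Lemma wo_lt_wf : well_founded (fun x y : Om => x < y).
Proof.
apply: wf_of_minimal => P [x /wo_min[m Pm mmin]].
by exists m => // y /mmin; rewrite leNgt => /negP.
Qed.

(** The rank of [x] is the least ordinal that is not the rank of a predecessor
   of [x]. As long as a value [g] is not taken, ranks stay below [g]; the first
   point of rank [g], if any, has at least [g] predecessors. This comparison
   stands in for the isomorphism of a well-order with an ordinal, which may
   not exist in [Om]. *)
Lemma wf_rank T (R : T -> T -> Prop) (S : set T) : well_founded R ->
    (forall x y, S x -> S y -> x <> y -> R x y \/ R y x) ->
    (forall x y, R x y -> S x) ->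
  exists f : T -> Om, forall g, S #<= below g \/
    exists2 x, S x /\ f x = g & below g `<=` f @` [set z | R z x].
Proof.
move=> wfR totR RS.
pose least (P : set Om) := xget \bot [set m | P m /\ forall y, P y -> m <= y].
have leastP P y : P y -> P (least P) /\ least P <= y.
  move=> Py; rewrite /least; case: xgetP => [m _ [Pm mmin]|none].
    by split=> //; exact: mmin.
  by have [m Pm mmin] := wo_min Py; case: (none m).
pose F x (f : forall z, R z x -> Om) :=
  least (~` [set y | exists z (Rzx : R z x), f z Rzx = y]).
pose f : T -> Om := Fix wfR (fun=> Om) F.
have fE x : f x = least (~` (f @` [set z | R z x])).
  rewrite /f Fix_eq /F => [|y p q pq].
    congr (least (~` _)); apply/seteqP; split => y.
      by move=> [z [Rzx <-]]; exists z.
    by move=> [z Rzx <-]; exists z, Rzx.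
  congr (least (~` _)); apply/seteqP; split => z [w [Rw <-]]; exists w, Rw.
    by rewrite pq.
  by rewrite pq.
exists f => g.
have [[x Sx fxg]|nog] := pselect (exists2 x, S x & f x = g).
  right; exists x => // y; rewrite /below /= -fxg => ltyfx.
  apply: contrapT => ny; have [_] := leastP (~` (f @` [set z | R z x])) y ny.
  by rewrite -fE leNgt ltyfx.
left.
have gC x : (~` (f @` [set z | R z x])) g by move=> [z /RS Sz fz]; apply: nog; exists z.
have nfx x : ~ (f @` [set z | R z x]) (f x).
  by rewrite fE; exact: (leastP _ _ (gC x)).1.
apply: (@card_le_inj _ _ _ _ f) => [x Sx|x y Sx Sy fxy].
  rewrite /below /= lt_neqAle; apply/andP; split.
    by apply/eqP => e; apply: nog; exists x.
  by rewrite fE; exact: (leastP _ _ (gC x)).2.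
apply: contrapT => /(totR _ _ Sx Sy)[Rxy|Ryx].
  by apply: (nfx y); exists x.
by apply: (nfx x); exists y.
Qed.

Lemma below_subset a b : a <= b -> below a `<=` below b.
Proof. by move=> ab x /= /lt_le_trans; apply. Qed.

Lemma below_le a b : a <= b -> below a #<= below b.
Proof. by move=> /below_subset/subset_card_le. Qed.

Lemma card_lt_below T (A : set T) k : card_lt A (below k) -> A #<= below k.
Proof. by case/andP. Qed.

(** The image of [A] under an injection into [below k] is well-ordered; if its
   ranks took every value less than [k], then [A] would be as large as
   [below k]. *)
Lemma card_lt_exists T (A : set T) k : card_lt A (below k) ->
  exists2 g, g < k & A #<= below g.
Proof.
move=> /andP[/(card_le_injP \bot)[j [jAk jI]] /negP nkA].
have totS x y : (j @` A) x -> (j @` A) y -> x <> y ->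
    ((j @` A) x /\ x < y) \/ ((j @` A) y /\ y < x).
  by move=> Sx Sy /eqP; rewrite neq_lt => /orP[]; [left|right].
have wfS : well_founded (fun x y => (j @` A) x /\ x < y).
  apply: wf_of_minimal => P [x /wo_min[m Pm mmin]].
  by exists m => // y /mmin ley [_]; rewrite ltNge ley.
have [f fP] := wf_rank wfS totS (fun x y => @proj1 _ _).
have Aj : A #<= j @` A by apply: (@card_le_inj _ _ _ _ j) => // x; exists x.
apply: contrapT => /forall2NP no; apply: nkA.
suff: below k `<=` f @` (j @` A).
  move=> /subset_card_le /card_le_trans; apply.
  by apply: card_le_trans (card_image_le _ _) (card_image_le _ _).
move=> g gk; have [Sg|[x [Sx fx] _]] := fP g; last by exists x.
by case: (no g) => // -[]; exact: card_le_trans Sg.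
Qed.

(** The least ordinal of the same size as [a] is a cardinal. *)
Lemma card_exists_cardinal a : exists2 m, is_cardinal m /\ m <= a &
  below a #<= below m.
Proof.
have [m am mmin] := wo_min (P := [set m | below a #<= below m]) (card_lexx _).
exists m => //; split; last exact/mmin/card_lexx.
move=> b bm; rewrite /card_lt below_le ?ltW //=; apply/negP => mb.
by have := mmin _ (card_le_trans am mb); rewrite leNgt bm.
Qed.

Lemma below_succ_cardinal k m a : is_succ_cardinal k m -> a < m ->
  below a #<= below k.
Proof.
move=> [_ _ mmin] am; have [l [lcard la] al] := card_exists_cardinal a.
apply: card_le_trans al (below_le _); rewrite leNgt; apply/negP => kl.
by have := le_lt_trans la am; rewrite ltNge mmin.
Qed.

(** * Squares and unions *)

Definition max_pair (p : Om * Om) : Om := Order.max p.1 p.2.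

(** Goedel's ordering of pairs: by maximum, then lexicographically. *)
Definition goedel_lt (p q : Om * Om) : Prop :=
  max_pair p < max_pair q \/ max_pair p = max_pair q /\
    (p.1 < q.1 \/ p.1 = q.1 /\ p.2 < q.2).

Lemma goedel_lt_max p q : goedel_lt p q -> max_pair p <= max_pair q.
Proof. by case=> [/ltW//|[-> _]]. Qed.

Lemma goedel_lt_total p q : p <> q -> goedel_lt p q \/ goedel_lt q p.
Proof.
move=> npq; rewrite /goedel_lt.
have [|| ->] := ltgtP (max_pair p) (max_pair q); [by left; left|by right; left|].
have [||e1] := ltgtP p.1 q.1; [by left; right; auto|by right; right; auto|].
have [||e2] := ltgtP p.2 q.2; [by left; right; auto|by right; right; auto|].
by case: npq; case: p q e1 e2 => [? ?] [? ?] /= -> ->.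
Qed.

Lemma goedel_lt_minimal (P : set (Om * Om)) : P !=set0 ->
  exists2 m, P m & forall p, P p -> ~ goedel_lt p m.
Proof.
move=> [p0 Pp0].
have [_ [p1 Pp1 <-] min1] :=
  wo_min (P := max_pair @` P) (ex_intro2 _ _ p0 Pp0 erefl).
pose P1 := [set p | P p /\ max_pair p = max_pair p1].
have [_ [p2 [Pp2 e2] <-] min2] :=
  wo_min (P := fst @` P1) (ex_intro2 _ _ p1 (conj Pp1 erefl) erefl).
pose P2 := [set p | P1 p /\ p.1 = p2.1].
have [_ [p3 [[Pp3 e3] e3'] <-] min3] := wo_min (P := snd @` P2)
  (ex_intro2 _ _ p2 (conj (conj Pp2 e2) erefl) erefl).
exists p3 => // p Pp; rewrite /goedel_lt e3 e3'; case=> [|[ep [|[ep' ]]]].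
- by rewrite ltNge min1//; exists p.
- by rewrite ltNge min2//; exists p.
- by rewrite ltNge min3//; exists p.
Qed.

Definition square_le k := below k `*` below k #<= below k.

(** The induction step of [infinite_square_le]: [a] is either finite or of the
   size of a cardinal [m < k], whose square has size [m] by induction. *)
Lemma closed_square_not_ge k a : is_cardinal k -> infinite_set (below k) ->
    (forall m, m < k -> is_cardinal m -> infinite_set (below m) -> square_le m) ->
    a < k ->
  ~ (below k #<= [set x | x <= a] `*` [set x | x <= a]).
Proof.
move=> kcard kinf IH ak kaa.
have aE : [set x | x <= a] = a |` below a.
  by apply/seteqP; split=> x /=; rewrite le_eqVlt => /predU1P.
have [afin|ainf] := pselect (finite_set (below a)).
  by apply/kinf/(card_le_finite kaa)/finite_setX; rewrite aE finite_setU.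
have [m [mcard ma] am] := card_exists_cardinal a.
have minf : infinite_set (below m) by move=> /(card_le_finite am).
have mk := le_lt_trans ma ak.
have am' : [set x | x <= a] #<= below m.
  by rewrite aE; apply: card_le_trans am; exact: infinite_setU1.
have /andP[_ /negP] := kcard _ mk; apply.
apply: card_le_trans (IH _ mk mcard minf); apply: card_le_trans kaa _.
exact: (card_le_prod \bot \bot).
Qed.

(** Under Goedel's ordering, the predecessors of a pair of ordinals less than
   [k] lie in a square over an ordinal less than [k], hence inductively are
   fewer than [k], so that no pair has rank [k]. *)
Lemma infinite_square_le k :
  is_cardinal k -> infinite_set (below k) -> square_le k.
Proof.
elim/(well_founded_ind (wo_lt_wf)): k => k IH kcard kinf.
pose S := below k `*` below k.
pose R p q := S p /\ goedel_lt p q.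
have wfR : well_founded R.
  apply: wf_of_minimal => P /goedel_lt_minimal[m Pm mmin].
  by exists m => // p /mmin + [].
have totR p q : S p -> S q -> p <> q -> R p q \/ R q p.
  by move=> Sp Sq /goedel_lt_total[]; [left|right].
have [f fP] := wf_rank wfR totR (fun p q => @proj1 _ _).
have [//|[p [[p1 p2] _] /subset_card_le kp]] := fP k.
have pk : max_pair p < k by rewrite /max_pair gt_max; apply/andP.
case: (closed_square_not_ge kcard kinf IH pk); apply: card_le_trans kp _.
apply: card_le_trans (card_image_le _ _) _; apply: subset_card_le.
by move=> q [_ /goedel_lt_max]; rewrite {1}/max_pair ge_max => /andP[].
Qed.

Lemma card_lt_square k a : is_cardinal k -> infinite_set (below k) -> a < k ->
  card_lt (below a `*` below a) (below k).
Proof.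
move=> kcard kinf ak; apply/andP; split.
  apply: card_le_trans (infinite_square_le kcard kinf).
  by apply: (card_le_prod \bot \bot); apply: below_le; exact: ltW.
apply/negP => kaa; apply: (closed_square_not_ge kcard kinf _ ak).
  by move=> m _; exact: infinite_square_le.
by apply: card_le_trans kaa _; apply: subset_card_le => p [/ltW ? /ltW ?].
Qed.

Lemma card_bigcup_le T I k (A : set I) (F : I -> set T) : square_le k ->
    A #<= below k -> (forall i, A i -> F i #<= below k) ->
  \bigcup_(i in A) F i #<= below k.
Proof.
move=> kk /(card_le_injP \bot)[j [jk jI]] Fk.
have /choice[h hP] : forall i, exists h : T -> Om, A i ->
    (forall x, F i x -> h x < k) /\
    (forall x y, F i x -> F i y -> h x = h y -> x = y).
  move=> i; have [/Fk /(card_le_injP \bot)[h hE]|nA] := pselect (A i).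
    by exists h.
  by exists (fun=> \bot) => /nA.
have /choice[p pP] : forall x, exists p : Om * Om,
    (\bigcup_(i in A) F i) x -> exists i, [/\ A i, F i x & p = (j i, h i x)].
  move=> x; have [[i Ai Fix]|nx] := pselect ((\bigcup_(i in A) F i) x).
    by exists (j i, h i x) => _; exists i.
  by exists (\bot, \bot) => /nx.
apply: card_le_trans kk; apply: (@card_le_inj _ _ _ _ p).
  move=> x /pP[i [Ai Fix ->]]; split; first exact: jk.
  by have [hk _] := hP i Ai; exact: hk.
move=> x y /pP[i [Ai Fix ->]] /pP[i' [Ai' Fiy ->]] [/jI e].
by rewrite -e// in Fiy *; have [_] := hP i Ai; apply.
Qed.

(** * Cofinalities *)

(** Cofinality only depends on sizes: a cofinal family indexed by any set of
   size at most [g] can be reindexed by [g]. *)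
Lemma has_cofinal_map_card T (C : set T) (s : T -> Om) a g : \bot < a ->
    C #<= below g -> (forall x, C x -> s x < a) ->
    (forall b, b < a -> exists2 x, C x & b <= s x) ->
  has_cofinal_map a g.
Proof.
move=> a0 /(card_le_injP \bot)[j [jg jI]] sa scof.
have /choice[f fP] : forall y, exists z, z < a /\
    (forall x, C x -> j x = y -> z = s x).
  move=> y; have [[x Cx jx]|no] := pselect (exists2 x, C x & j x = y).
    exists (s x); split=> [|x' Cx' jx']; first exact: sa.
    by congr s; apply: jI => //; rewrite jx.
  by exists \bot; split=> // x Cx jx; case: no; exists x.
exists f => [x _|b /scof[x Cx bx]]; first by have [] := fP x.
exists (j x); first exact: jg.
by have [_ /(_ x Cx erefl)->] := fP (j x).
Qed.

Lemma cof_le a : cof a <= a.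
Proof. by apply: (cofP a Om_wo).2; exists id => // b ba; exists b. Qed.

(** An unbounded family of fewer than [cof a] values would be a cofinal map
   from some [g < cof a]. *)
Lemma cof_bounded T (C : set T) (s : T -> Om) a : \bot < a ->
    card_lt C (below (cof a)) -> (forall x, C x -> s x < a) ->
  exists2 b, b < a & forall x, C x -> s x < b.
Proof.
move=> a0 /(card_lt_exists)[g ga Cg] sa; apply: contrapT => /forall2NP no.
suff /(cofP a Om_wo).2 : has_cofinal_map a g by rewrite leNgt ga.
apply: (has_cofinal_map_card a0 Cg sa) => b ba.
apply: contrapT => /forall2NP nb; case: (no b) => // -[] x Cx.
by case: (nb x) => // /negP; rewrite -ltNge.
Qed.

Lemma cof_cardinal a : is_cardinal (cof a).
Proof.
move=> g ga; rewrite /card_lt below_le ?ltW//=; apply/negP => ag.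
have [[f fa fcof] cofmin] := cofP a Om_wo.
have a0 : \bot < a by apply: le_lt_trans (le0x g) (lt_le_trans ga (cof_le a)).
by have := cofmin g (has_cofinal_map_card a0 ag fa fcof); rewrite leNgt ga.
Qed.

(** This is the identity [k^{<cof k} = k]: a function from fewer than [cof k]
   points to [k] is bounded by some [c < k], so that its graph is a subset of a
   set of size less than [k], and [2^{<k} = k]. *)
Lemma card_functions_lt_cof T (C : set T) k : is_cardinal k ->
    infinite_set (below k) -> weak_power_bound k k ->
    card_lt C (below (cof k)) ->
  [set s : T -> Om | (forall x, C x -> s x < k) /\ (forall x, ~ C x -> s x = \bot)]
    #<= below k.
Proof.
move=> kcard kinf kpow Ck.
have k0 : \bot < k.
  by have [x /= xk] := infinite_setN0 kinf; exact: le_lt_trans (le0x x) xk.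
pose G c := [set s : T -> Om |
  (forall x, C x -> s x < c) /\ (forall x, ~ C x -> s x = \bot)].
apply: (@card_le_trans _ _ _ (\bigcup_(c in below k) G c)).
  apply: subset_card_le => s [sk s0].
  by have [c ck sc] := cof_bounded k0 Ck sk; exists c.
apply: card_bigcup_le (card_lexx _) _; first exact: infinite_square_le.
move=> c /= ck.
have [g gk Cg] := card_lt_exists Ck.
pose m := Order.max g c.
have mk : m < k by rewrite gt_max ck (lt_le_trans gk (cof_le k)).
have [e ek me] := card_lt_exists (card_lt_square kcard kinf mk).
have [l [lcard le] el] := card_exists_cardinal e.
apply: card_le_trans (kpow _ lcard (le_lt_trans le ek)).
apply: (@card_le_trans _ _ _ [set S | S `<=` C `*` below c]); last first.
  apply: (card_le_subsets \bot); apply: card_le_trans el.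
  apply: card_le_trans me; apply: (card_le_prod \bot \bot).
    by apply: card_le_trans Cg (below_le _); rewrite le_max lexx.
  by apply: below_le; rewrite le_max lexx orbT.
apply: (@card_le_inj _ _ _ _ (fun s => [set (x, s x) | x in C])).
  by move=> s [sc _] _ [x Cx <-]; split=> //; exact: sc.
move=> s s' [sc s0] [sc' s0'] ss'; apply/funext => x.
have [Cx|nCx] := pselect (C x); last by rewrite s0// s0'.
have : [set (x, s x) | x in C] (x, s x) by exists x.
by rewrite ss' => -[x' _ [-> ->]].
Qed.

End Ordinals.

(** * The hierarchy *)

Lemma bigcap_setC_bigcup T (C : set (set T)) :
  ~` (\bigcap_(A in C) A) = \bigcup_(A in setC @` C) A.
Proof. by rewrite bigcup_image setC_bigcap. Qed.

Lemma bigcup_setC_bigcap T (C : set (set T)) :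
  ~` (\bigcup_(A in C) A) = \bigcap_(A in setC @` C) A.
Proof. by rewrite bigcap_image setC_bigcup. Qed.

Lemma card_lt_image T T' U (f : T -> T') (A : set T) (B : set U) :
  card_lt A B -> card_lt (f @` A) B.
Proof.
move=> /andP[AB /negP BA]; apply/andP; split.
  exact: card_le_trans (card_image_le _ _) AB.
by apply/negP => /card_le_trans/(_ (card_image_le _ _)).
Qed.

(** In a regular space the closures of the basic open sets included in an open
   set already cover it. *)
Lemma open_bigcup_closure (X : topologicalType) (B : set (set X)) (A : set X) :
    regular_space X -> basis B -> open A ->
  A = \bigcup_(F in closure @` [set U | B U /\ closure U `<=` A]) F.
Proof.
move=> Xreg [Bo Bb] Ao; rewrite bigcup_image; apply/seteqP; split; last first.
  by move=> x [U [_ UA] /UA].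
move=> x Ax; have [V xV VA] := Xreg x A (open_nbhs_nbhs (conj Ao Ax)).
have [U [BU Ux] UV] := Bb x V xV.
exists U; last exact: subset_closure.
by split=> //; apply: subset_trans VA; exact: closureS.
Qed.

Section Hierarchy.
Context {d : Order.disp_t} {Om : bOrderType d} {X : topologicalType}.
Context (Om_wo : well_order (<=%O : rel Om)).
Implicit Types (a b c g nu : Om) (A : set X) (C : set (set X)).

Lemma ord_oneP a : \bot < a -> succ_of \bot (ord_one : Om).
Proof.
move=> a0.
have [m m0 mmin] := wo_min Om_wo (P := [set c | \bot < c]) a0; rewrite /ord_one.
by case: xgetP => [c _ //|/(_ m)[]]; split.
Qed.

Section Kappa.
Context (k : Om).

Lemma Pi0E a A : Pi0 X k a A <-> Sigma0 X k a (~` A).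
Proof.
split; first by case=> b B; rewrite setCK.
by move=> /Pi0_setC; rewrite setCK.
Qed.

Lemma Sigma0_setC a A : Sigma0 X k a A <-> Pi0 X k a (~` A).
Proof. by rewrite Pi0E setCK. Qed.

Lemma Sigma0_oneE A : Sigma0 X k ord_one A -> open A.
Proof.
move E : (ord_one : Om) => a SA; case: SA E => [//|b C + _ _ E].
by rewrite -E ltxx.
Qed.

Lemma Sigma0_gt1P a A : ord_one < a -> Sigma0 X k a A ->
  exists C, [/\ C #<= below k, A = \bigcup_(B in C) B &
    forall B, C B -> exists2 b, ord_one <= b < a & Pi0 X k b B].
Proof.
move=> a1 SA; case: SA a1 => [B _|b C _ Ck CP _]; first by rewrite ltxx.
by exists C.
Qed.

Context (k_card : is_cardinal k) (k_inf : infinite_set (below k)).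
Context (X_regular : regular_space X) (X_weight : weight_le X k).

Let k_gt0 : \bot < k.
Proof. by have [x xk] := infinite_setN0 k_inf; exact: le_lt_trans (le0x x) xk. Qed.

Let k_square : square_le k.
Proof. exact: infinite_square_le. Qed.

Lemma closed_Pi0_one A : closed A -> Pi0 X k ord_one A.
Proof. by move=> Ac; apply/Pi0E/Sigma0_open; exact: closed_openC. Qed.

(** The decomposition of a [Sigma] set of level above 1 remains admissible at
   later levels; only open sets have to be decomposed anew. *)
Lemma Sigma0_le a b A : ord_one <= a -> a <= b ->
  Sigma0 X k a A -> Sigma0 X k b A.
Proof.
move=> + + SA; case: SA => [B Bo _|c C c1 Ck CP _ cb]; last first.
  apply: Sigma0_bigcup => //; first exact: lt_le_trans cb.
  by move=> B /CP[e /andP[e1 ec]]; exists e => //; rewrite e1 (lt_le_trans ec).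
rewrite le_eqVlt => /predU1P[<-|b1]; first exact: Sigma0_open.
have [V Vb Vk] := X_weight.
rewrite (open_bigcup_closure X_regular Vb Bo); apply: Sigma0_bigcup => //.
  apply: card_le_trans (card_image_le _ _) (card_le_trans _ Vk).
  by apply: subset_card_le => U [].
move=> _ [U _ <-]; exists ord_one; first by rewrite lexx.
exact/closed_Pi0_one/closed_closure.
Qed.

Lemma Pi0_le a b A : ord_one <= a -> a <= b -> Pi0 X k a A -> Pi0 X k b A.
Proof. by move=> a1 ab /Pi0E/(Sigma0_le a1 ab)/Pi0E. Qed.

Lemma Pi0_Sigma0 a b A : ord_one <= a -> a < b -> Pi0 X k a A -> Sigma0 X k b A.
Proof.
move=> a1 ab PA; rewrite -(bigcup_set1 id A).
apply: Sigma0_bigcup; first exact: le_lt_trans ab.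
  by apply: (@card_le_inj _ _ _ _ (fun=> \bot)) => // x y -> ->.
by move=> _ ->; exists a => //; rewrite a1.
Qed.

Lemma Sigma0_Pi0 a b A : ord_one <= a -> a < b -> Sigma0 X k a A -> Pi0 X k b A.
Proof. by move=> a1 ab /Sigma0_setC/(Pi0_Sigma0 a1 ab)/Pi0E. Qed.

Lemma Sigma0_bigcup_le a C : ord_one <= a -> C #<= below k ->
  C `<=` Sigma0 X k a -> Sigma0 X k a (\bigcup_(A in C) A).
Proof.
rewrite le_eqVlt => /predU1P[<- _ CS|a1 Ck CS].
  by apply: Sigma0_open; apply: bigcup_open => A /CS/Sigma0_oneE.
have /choice[D DP] : forall A, exists D, C A -> [/\ D #<= below k,
    A = \bigcup_(B in D) B &
    forall B, D B -> exists2 b, ord_one <= b < a & Pi0 X k b B].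
  move=> A; have [/CS/(Sigma0_gt1P a1)[D DP]|nCA] := pselect (C A).
    by exists D.
  by exists set0 => /nCA.
have -> : \bigcup_(A in C) A = \bigcup_(B in \bigcup_(A in C) D A) B.
  by rewrite bigcup_bigcup; apply: eq_bigcupr => A /DP[_ AE _].
apply: Sigma0_bigcup => //.
  by apply: card_bigcup_le => // A /DP[].
by move=> B [A /DP[_ _]]; apply.
Qed.

Lemma Pi0_bigcap_le a C : ord_one <= a -> C #<= below k ->
  C `<=` Pi0 X k a -> Pi0 X k a (\bigcap_(A in C) A).
Proof.
move=> a1 Ck CP; apply/Pi0E; rewrite bigcap_setC_bigcup.
apply: Sigma0_bigcup_le => //; first exact: card_le_trans (card_image_le _ _) Ck.
by move=> _ [A /CP/Pi0E SA <-].
Qed.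

(** Padding with the empty set, which is [Pi] at every level, turns the pieces
   into a sequence of length [k], so that choosing a piece amounts to choosing
   an ordinal less than [k]. *)
Lemma Sigma0_succP a b A : ord_one <= b -> succ_of b a -> Sigma0 X k a A ->
  exists2 e : Om -> set X, (forall i, Pi0 X k b (e i)) &
    A = \bigcup_(i in below k) e i.
Proof.
move=> b1 [ba bmin] /(Sigma0_gt1P (le_lt_trans b1 ba))[C [Ck -> CP]].
have [g gP] := card_le_surjP \bot set0 Ck.
exists (fun i => if pselect (C (g i)) then g i else set0) => [i|].
  case: (pselect (C (g i))) => [Cg|nCg].
    have [c /andP[c1 ca] Pc] := CP _ Cg; apply: (Pi0_le c1 _ Pc).
    by rewrite leNgt; apply/negP => /bmin; rewrite leNgt ca.
  apply: (Pi0_le (lexx _) b1); apply: closed_Pi0_one; exact: closed0.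
apply/seteqP; split=> [x [B CB Bx]|x [i ik]]; last first.
  by case: (pselect (C (g i))) => // Cg gx; exists (g i).
have [i ik gi] := gP B CB; exists i => //.
by rewrite gi; case: (pselect (C B)).
Qed.

(** Distributing the intersection over the unions turns it into a union over
   the choice functions, of which there are at most [k]. *)
Lemma Sigma0_bigcap_succ a b C : weak_power_bound k k ->
    ord_one <= b -> succ_of b a -> C `<=` Sigma0 X k a ->
    card_lt C (below (cof k)) -> Sigma0 X k a (\bigcap_(A in C) A).
Proof.
move=> kpow b1 ba CS Ck.
have /choice[e eP] : forall A, exists e : Om -> set X, C A ->
    (forall i, Pi0 X k b (e i)) /\ A = \bigcup_(i in below k) e i.
  move=> A; have [/CS/(Sigma0_succP b1 ba)[e eb eA]|nCA] := pselect (C A).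
    by exists e.
  by exists (fun=> set0) => /nCA.
pose F := [set s : set X -> Om |
  (forall A, C A -> s A < k) /\ (forall A, ~ C A -> s A = \bot)].
pose H (s : set X -> Om) := \bigcap_(A in C) e A (s A).
have -> : \bigcap_(A in C) A = \bigcup_(B in H @` F) B.
  rewrite bigcup_image; apply/seteqP; split=> [x Cx|x [s [sk _] Hx] A CA].
    have /choice[s sP] : forall A, exists i,
        (C A -> i < k /\ e A i x) /\ (~ C A -> i = \bot).
      move=> A; have [CA|nCA] := pselect (C A); last by exists \bot.
      have [_ AE] := eP A CA.
      have [i ik eix] : (\bigcup_(i in below k) e A i) x by rewrite -AE; exact: Cx.
      by exists i; split=> [_|/(_ CA)].
    exists s => [|A CA]; last by have [/(_ CA)[]] := sP A.
    by split=> A; have [sC snC] := sP A; [move=> /sC[]|move=> /snC].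
  by have [_ ->] := eP A CA; exists (s A); [exact: sk|exact: Hx].
have [a_gt_b _] := ba.
apply: Sigma0_bigcup; first exact: le_lt_trans a_gt_b.
  apply: card_le_trans (card_image_le _ _) _.
  exact: (card_functions_lt_cof Om_wo).
move=> _ [s _ <-]; exists b; first by rewrite b1.
rewrite /H -(bigcap_image _ (fun A => e A (s A)) id).
apply: Pi0_bigcap_le => //.
  apply: card_le_trans (card_image_le _ _) (card_le_trans (card_lt_below Ck) _).
  exact/below_le/cof_le.
by move=> _ [A /eP[eb _] <-]; exact: eb.
Qed.

(** Each [A] in [C] is the increasing union over [g < a] of the part of its
   decomposition that lives at levels up to [g]. As [C] is smaller than [cof a],
   a point of the intersection is in the [g]-th part of all [A] for a common
   [g], so that intersection and union commute. *)
Lemma Sigma0_bigcap_limit a C : ord_one < a -> ~ is_successor a ->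
    below a #<= below k -> C `<=` Sigma0 X k a ->
    card_lt C (below (cof a)) -> Sigma0 X k a (\bigcap_(A in C) A).
Proof.
move=> a1 alim ak CS Ca.
have a_gt0 : \bot < a by have [one_gt0 _] := ord_oneP k_gt0; exact: lt_trans a1.
have next g : g < a -> exists2 h, g < h & h < a.
  move=> ga; apply: contrapT => /forall2NP no; apply: alim; exists g.
  split=> // h gh; rewrite leNgt; apply/negP => ha.
  by case: (no h).
have /choice[D DP] : forall A, exists D, C A -> [/\ D #<= below k,
    A = \bigcup_(B in D) B &
    forall B, D B -> exists2 b, ord_one <= b < a & Pi0 X k b B].
  move=> A; have [/CS/(Sigma0_gt1P a1)[D DP]|nCA] := pselect (C A).
    by exists D.
  by exists set0 => /nCA.
pose low g A := [set B | D A B /\ exists2 b, ord_one <= b <= g & Pi0 X k b B].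
pose H g := \bigcap_(A in C) \bigcup_(B in low g A) B.
have -> : \bigcap_(A in C) A =
    \bigcup_(B in H @` [set g | ord_one <= g < a]) B.
  rewrite bigcup_image; apply/seteqP; split=> [x Cx|x [g _ Hx] A CA]; last first.
    have [_ -> _] := DP A CA; have [B [DB _] Bx] := Hx A CA.
    by exists B.
  have /choice[s sP] : forall A, exists b, C A -> b < a /\
      exists B, [/\ D A B, B x, ord_one <= b & Pi0 X k b B].
    move=> A; have [CA|nCA] := pselect (C A); last by exists \bot => /nCA.
    have [_ AE Dlow] := DP A CA.
    have [B DB Bx] : (\bigcup_(B in D A) B) x by rewrite -AE; exact: Cx.
    have [b /andP[b1 ba] Pb] := Dlow B DB.
    by exists b => _; split=> //; exists B.
  have [g ga sg] := cof_bounded Om_wo a_gt0 Ca (fun A CA => (sP A CA).1).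
  exists (Order.max g ord_one) => [|A CA].
    by rewrite /= le_max lexx orbT gt_max ga a1.
  have [_ [B [DB Bx s1 Ps]]] := sP A CA.
  exists B => //; split=> //; exists (s A) => //.
  by rewrite s1 le_max (ltW (sg A CA)).
apply: Sigma0_bigcup => //.
  apply: card_le_trans (card_image_le _ _) (card_le_trans _ ak).
  by apply: subset_card_le => g /andP[].
move=> _ [g /andP[g1 ga] <-].
(* Two steps up: the union of the pieces up to [g] is [Sigma] at level [h],
   hence [Pi] at level [h'], where intersections can be taken. *)
have [h gh ha] := next g ga; have [h' hh' h'a] := next h ha.
have h1 : ord_one <= h by apply: le_trans g1 (ltW gh).
exists h'; first by rewrite (le_trans h1 (ltW hh')).
rewrite /H -(bigcap_image _ (fun A => \bigcup_(B in low g A) B) id).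
apply: Pi0_bigcap_le; first exact: le_trans (ltW hh').
  apply: card_le_trans (card_image_le _ _) (card_le_trans (card_lt_below Ca) _).
  by apply: card_le_trans ak; exact/below_le/cof_le.
move=> _ [A /DP[Dk _ _] <-]; apply: (Sigma0_Pi0 h1 hh').
apply: Sigma0_bigcup; first exact: le_lt_trans gh.
  by apply: card_le_trans Dk; apply: subset_card_le => B [].
move=> B [_ [b /andP[b1 bg] Pb]]; exists b => //.
by rewrite b1 (le_lt_trans bg).
Qed.

(** That [nu] is a cardinal matters for the algebra clause: a union of length
   [g < nu] must be a union of a family of size smaller than [nu]. *)
Lemma hierarchy_closure_bigcap a nu : ord_one <= a -> is_cardinal nu ->
    below nu #<= below k -> closed_bigcap_lt nu (Sigma0 X k a) ->
  hierarchy_closure X k a nu.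
Proof.
move=> a1 nu_card nuk Scap.
have Pcup : closed_bigcup_lt nu (Pi0 X k a).
  move=> C CP Cnu; apply/Pi0E; rewrite bigcup_setC_bigcap.
  apply: Scap; last exact: card_lt_image.
  by move=> _ [A /CP/Pi0E SA <-].
have Dcup : closed_bigcup_lt nu (Delta0 X k a).
  move=> C CD Cnu; split; last by apply: Pcup => // A /CD[].
  apply: Sigma0_bigcup_le => //; last by move=> A /CD[].
  exact: card_le_trans (card_lt_below Cnu) nuk.
have Dcap : closed_bigcap_lt nu (Delta0 X k a).
  move=> C CD Cnu; split; first by apply: Scap => // A /CD[].
  apply: Pi0_bigcap_le => //; last by move=> A /CD[].
  exact: card_le_trans (card_lt_below Cnu) nuk.
have DC : closed_setC (Delta0 X k a).
  by move=> A [SA /Pi0E PA]; split=> //; exact/Sigma0_setC.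
split; split=> //.
- move=> F FS; rewrite -(bigcup_image _ F id).
  apply: Sigma0_bigcup_le => //; first exact: card_image_le.
  by move=> _ [i /FS ? <-].
- move=> F FP; rewrite -(bigcap_image _ F id).
  apply: Pi0_bigcap_le => //; first exact: card_image_le.
  by move=> _ [i /FP ? <-].
- split=> // g gnu F FD; rewrite -(bigcup_image _ F id).
  apply: Dcup; first by move=> _ [i /FD ? <-].
  exact/card_lt_image/nu_card.
Qed.

End Kappa.
End Hierarchy.

Theorem proposition4p1 (d : Order.disp_t) (Om : bOrderType d)
    (Om_wo : well_order (<=%O : rel Om))
    (kappa kappa_plus : Om)
    (kappa_card : is_cardinal kappa)
    (kappa_uncountable : ~ countable (below kappa))
    (kappa_pow : weak_power_eq kappa)
    (kappa_plusP : is_succ_cardinal kappa kappa_plus)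
    (X : topologicalType)
    (X_nonempty : inhabited X)
    (X_regular : regular_space X)
    (X_hausdorff : hausdorff_space X)
    (X_weight : weight_le X kappa) :
  (forall alpha : Om, (ord_one < alpha < kappa_plus)%O ->
     hierarchy_closure X kappa alpha (hat kappa alpha)) /\
  (additive X (cof kappa) -> hierarchy_closure X kappa ord_one (cof kappa)).
Proof.
have kappa_inf : infinite_set (below kappa).
  by move=> /finite_set_countable.
have [kappa_bound _] := kappa_pow.
split=> [alpha /andP[alpha1 alpha_plus]|Xadd]; last first.
  apply: hierarchy_closure_bigcap => //; first exact: cof_cardinal.
    exact/below_le/cof_le.
  move=> C CS Ck; apply/Sigma0_open/Xadd => // A /CS; exact: Sigma0_oneE.
have alpha_le := below_succ_cardinal Om_wo kappa_plusP alpha_plus.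
apply: hierarchy_closure_bigcap => //; first exact: ltW.
- by rewrite /hat; case: asboolP => _; exact: cof_cardinal.
- rewrite /hat; case: asboolP => _; first exact/below_le/cof_le.
  by apply: card_le_trans alpha_le; exact/below_le/cof_le.
move=> C CS; rewrite /hat; case: asboolP => [[beta beta_alpha]|alpha_lim].
  have kappa_gt0 : \bot < kappa.
    by have [x xk] := infinite_setN0 kappa_inf; exact: le_lt_trans (le0x x) xk.
  have [one_gt0 one_min] := ord_oneP Om_wo kappa_gt0.
  (* If beta were 0, alpha would be 1. *)
  have beta1 : ord_one <= beta.
    apply: one_min; rewrite lt0x; apply/eqP => beta0.
    have [_ alpha_min] := beta_alpha; rewrite beta0 in alpha_min.
    by have := alpha_min _ one_gt0; rewrite leNgt alpha1.
  exact: Sigma0_bigcap_succ beta_alpha CS.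
exact: Sigma0_bigcap_limit.
Qed.
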